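(* For a finite alphabet of size $S$, let $\mathcal{D}_0(S)$ be the set of probability distributions on it, and define the minimax redundancy for memoryless sources $$\tilde R_n(\mathcal{D}_0(S))=\inf_{Q}\sup_{P\in\mathcal{D}_0(S)}\frac1n D(P_{X^n}\|Q_{X^n}),$$ where $P_{X^n}=P^{\otimes n}$ is the law of $n$ i.i.d. draws from $P$ and the infimum is over all probability distributions $Q_{X^n}$ on sequences of length $n$. Suppose $S=\alpha n$ with $\alpha\in(0,\frac{e}{2\pi})$ a constant. Then $$\liminf_{n}\tilde R_n(\mathcal{D}_0(S))\ge\frac{\alpha}{2}\lg\Big(\frac{e}{2\pi\alpha}\Big),\qquad \limsup_n\tilde R_n(\mathcal{D}_0(S))\le\lg B_\alpha,$$ where $B_\alpha=\alpha C_\alpha^{\alpha+2}e^{-1/C_\alpha}$ and $C_\alpha=\frac12+\frac12\sqrt{1+\frac4\alpha}$.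
   Context: $\lg=\log_2$. $D(P\|Q)=\sum_x P(x)\lg\frac{P(x)}{Q(x)}$ is the Kullback–Leibler divergence. *)

(* Defs.v *)
From HB Require Import structures.
From mathcomp Require Import all_boot all_order all_algebra.
From mathcomp Require Import all_classical all_reals all_analysis.
Set Implicit Arguments. Unset Strict Implicit. Unset Printing Implicit Defensive.
Import Order.TTheory GRing.Theory Num.Theory.
Local Open Scope classical_set_scope.
Local Open Scope ring_scope.

Section Defs.
Variable R : realType.

Definition lg (x : R) : R := ln x / ln 2.

Definition distr (T : finType) : set (T -> R) :=
  [set P | (forall x, 0 <= P x) /\ \sum_(x : T) P x = 1].

(* Kullback-Leibler divergence D(P||Q) in bits, with conventions
   0 lg(0/q) = 0 and p lg(p/0) = +oo for p > 0. *)
Definition KL (T : finType) (P Q : T -> R) : \bar R :=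
  if [forall x, (0 < P x) ==> (0 < Q x)]
  then (\sum_(x : T) (if 0 < P x then P x * lg (P x / Q x) else 0))%:E
  else +oo%E.

Definition iid (T : finType) (n : nat) (P : T -> R) : {ffun 'I_n -> T} -> R :=
  fun x => \prod_(i < n) P (x i).

Definition minimax_red (S n : nat) : \bar R :=
  ereal_inf [set ereal_sup [set ((n%:R)^-1)%:E * KL (iid (n:=n) P) Q
                           | P in distr (T:='I_S)]%E
            | Q in distr (T:={ffun 'I_n -> 'I_S})].

Definition C_alpha (a : R) : R := 1/2 + 1/2 * Num.sqrt (1 + 4 / a).
Definition B_alpha (a : R) : R :=
  a * (C_alpha a) `^ (a + 2) * expR (- (C_alpha a)^-1).

End Defs.

(* Main.v *)
(** Upper bound.  Against the normalised maximum likelihood distribution every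
    divergence is at most the logarithm of the Shtarkov sum
    [Z = \sum_x \prod_i (k_i(x) / n) ^ k_i(x)], which up to the factor
    [n! / n^n] is the [n]-th coefficient of [(\sum_k k^k z^k / k!) ^ S].  For
    [z = t e^{-t}] with [0 < t < 1] the inner series is at most [1 / (1 - t)],
    and Cauchy's coefficient bound at [t = 1 - 1 / C_alpha] gives [B_alpha].

    Lower bound.  Put the uniform prior on the parameters [m / (n L)], where [m]
    runs through the compositions of [n L] into [S] parts.  By Gibbs' inequality
    the worst divergence is at least the logarithm of the number of compositions
    plus the mean log-probability of any decoder of [m] from the counts.  The
    product of [S] discretised Gaussians of common variance [n L^2 / S] is such a
    decoder, since the sum over [i] of the mean square errors is at most [n L^2]
    for every [m].  Taking [L = n] and [n] to infinity gives
    [(alpha / 2) lg (e / (2 pi alpha))]. *)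

Require Import Defs.
From HB Require Import structures.
From mathcomp Require Import all_boot all_order all_algebra.
From mathcomp Require Import all_classical all_reals all_analysis.
From mathcomp Require Import measurable_realfun.
From mathcomp Require Import ring lra.
Import Order.TTheory GRing.Theory Num.Theory numFieldNormedType.Exports.
Local Open Scope classical_set_scope.
Local Open Scope ring_scope.
Set Implicit Arguments.
Unset Strict Implicit.

(** * Words and their letter counts *)

Definition ffun_cons (T : finType) n (t : T) (g : {ffun 'I_n -> T}) :
  {ffun 'I_n.+1 -> T} := [ffun i => if unlift ord0 i is Some j then g j else t].

Lemma ffun_cons0 (T : finType) n (t : T) (g : {ffun 'I_n -> T}) :
  ffun_cons t g ord0 = t.
Proof. by rewrite ffunE unlift_none. Qed.

Lemma ffun_consS (T : finType) n (t : T) (g : {ffun 'I_n -> T}) i :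
  ffun_cons t g (lift ord0 i) = g i.
Proof. by rewrite ffunE liftK. Qed.

Lemma sum_ffun_cons (V : nmodType) (T : finType) n (F : {ffun 'I_n.+1 -> T} -> V) :
  \sum_f F f = \sum_t \sum_g F (ffun_cons t g).
Proof.
rewrite pair_big /=.
rewrite (reindex (fun p : T * {ffun 'I_n -> T} => ffun_cons p.1 p.2)) //.
exists (fun f : {ffun 'I_n.+1 -> T} =>
  (f ord0, [ffun i : 'I_n => f (lift ord0 i)])) => [[t g] _|f _] /=.
  by rewrite ffun_cons0; congr (_, _); apply/ffunP => i; rewrite ffunE ffun_consS.
apply/ffunP => i; case: (unliftP ord0 i) => [j|] ->.
  by rewrite ffun_consS ffunE.
by rewrite ffun_cons0.
Qed.

Definition count_of (T : finType) n (x : {ffun 'I_n -> T}) (i : T) : nat :=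
  (\sum_(j < n) (x j == i))%N.

Lemma count_of_cons (T : finType) n (t : T) (x : {ffun 'I_n -> T}) i :
  count_of (ffun_cons t x) i = ((t == i) + count_of x i)%N.
Proof.
rewrite /count_of big_ord_recl ffun_cons0; congr (_ + _)%N.
by apply: eq_bigr => j _; rewrite ffun_consS.
Qed.

Lemma prod_count_of (R : comPzSemiRingType) (T : finType) n (f : T -> R)
    (x : {ffun 'I_n -> T}) :
  \prod_(j < n) f (x j) = \prod_i f i ^+ count_of x i.
Proof.
under [RHS]eq_bigr do rewrite -prodrXr.
transitivity (\prod_(j < n) \prod_i f i ^+ (x j == i)).
  apply: eq_bigr => j _; rewrite (bigD1 (x j)) //= eqxx expr1 big1 ?mulr1 //.
  by move=> i /negbTE; rewrite eq_sym => ->; rewrite expr0.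
by rewrite exchange_big.
Qed.

(** * Derivatives and coefficients of products of polynomials *)

Lemma deriv_prod (R : comNzRingType) (I : eqType) (r : seq I) (p : I -> {poly R}) :
  uniq r ->
  (\prod_(i <- r) p i)^`() =
    \sum_(j <- r) \prod_(i <- r) (if j == i then (p i)^`() else p i).
Proof.
elim: r => [|a r IH] /=; first by rewrite !big_nil -polyC1 derivC.
move=> /andP[ar ur]; rewrite !big_cons derivM IH // eqxx big_distrr /=.
congr (_ * _ + _).
  rewrite !big_seq; apply: eq_bigr => i ir.
  by case: eqP => // ai; rewrite ai ir in ar.
rewrite !big_seq; apply: eq_bigr => j jr; rewrite big_cons.
by case: eqP => // aj; rewrite -aj jr in ar.
Qed.

(** Leibniz' rule indexed by words: letter [j] of the word records which factor is differentiated at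
    step [j], so no multinomial coefficient appears. *)
Lemma derivn_prod (R : comNzRingType) (I : finType) n (p : I -> {poly R}) :
  (\prod_i p i)^`(n) = \sum_(x : {ffun 'I_n -> I}) \prod_i (p i)^`(count_of x i).
Proof.
elim: n p => [|n IH] p.
  rewrite derivn0 (bigD1 [ffun i : 'I_0 => match notF (ltn_ord i) with end]) //=.
  rewrite [X in _ + X]big1 ?addr0; last first.
    by move=> x /negP[]; apply/eqP/ffunP => -[].
  by apply: eq_bigr => i _; rewrite /count_of big_ord0 derivn0.
rewrite derivSn deriv_prod ?index_enum_uniq // raddf_sum sum_ffun_cons.
apply: eq_bigr => t _; rewrite [LHS]IH; apply: eq_bigr => x _.
apply: eq_bigr => i _; rewrite count_of_cons.
by case: (t == i) => //; rewrite derivSn.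
Qed.

Lemma coef0_derivn (R : nzSemiRingType) (p : {poly R}) n :
  (p^`(n)).[0] = p`_n *+ n`!.
Proof. by rewrite horner_coef0 coef_derivn addn0 ffactnn. Qed.

Lemma coef_le_horner (R : numDomainType) (p : {poly R}) (z : R) n :
  (forall k, 0 <= p`_k) -> 0 <= z -> p`_n * z ^+ n <= p.[z].
Proof.
move=> p0 z0; have [np|pn] := ltnP n (size p); last first.
  by rewrite nth_default // mul0r horner_coef sumr_ge0 // => i _; rewrite mulr_ge0 ?exprn_ge0.
rewrite horner_coef (bigD1 (Ordinal np)) //= lerDl sumr_ge0 // => i _.
by rewrite mulr_ge0 ?exprn_ge0.
Qed.

Lemma coef_prod_ge0 (R : numDomainType) (I : Type) (r : seq I) (p : I -> {poly R}) :
  (forall i k, 0 <= (p i)`_k) -> forall k, 0 <= (\prod_(i <- r) p i)`_k.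
Proof.
move=> p0; elim/big_ind: _ => [k|p1 p2 h1 h2 k|i _ k //].
  by rewrite coef1 ler0n.
by rewrite coefM sumr_ge0 // => j _; rewrite mulr_ge0.
Qed.

(* Cauchy's coefficient bound for the product of the exponential generating
   functions of the [g i]. *)
Lemma sum_prod_count_le (R : realFieldType) (I : finType) n (g : I -> nat -> R) (z : R) :
  (forall i k, 0 <= g i k) -> 0 <= z ->
  (\sum_(x : {ffun 'I_n -> I}) \prod_i g i (count_of x i)) * z ^+ n
    <= n`!%:R * \prod_i \sum_(k < n.+1) g i k / k`!%:R * z ^+ k.
Proof.
(* Truncating the generating function at degree [n] loses nothing, as no letter occurs more than [n]
   times; the [k]-th derivative of [p i] at 0 is then [g i k]. *)
move=> g0 z0; pose p i := \poly_(k < n.+1) (g i k / k`!%:R).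
have p0 i k : 0 <= (p i)`_k.
  by rewrite coef_poly; case: ifP => // _; rewrite divr_ge0.
have -> : \sum_(x : {ffun 'I_n -> I}) \prod_i g i (count_of x i) =
    (\prod_i p i)`_n *+ n`!.
  rewrite -coef0_derivn derivn_prod horner_sum; apply: eq_bigr => x _.
  rewrite horner_prod; apply: eq_bigr => i _; rewrite coef0_derivn coef_poly.
  have -> : (count_of x i < n.+1)%N.
    rewrite ltnS /count_of -[X in (_ <= X)%N]card_ord -sum1_card.
    by apply: leq_sum => j _; case: eqP.
  by rewrite -[RHS]mulr_natr divfK // pnatr_eq0 -lt0n fact_gt0.
rewrite -[_ *+ n`!]mulr_natl -mulrA ler_pM2l ?ltr0n ?fact_gt0 //.
apply: le_trans (coef_le_horner _ _ z0) _; first exact: coef_prod_ge0.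
rewrite horner_prod le_eqVlt; apply/orP; left; apply/eqP.
by apply: eq_bigr => i _; rewrite horner_poly.
Qed.

(** * Upper bound *)

(** Truncation of Abel's series, which sums to [e^{tx} / (1 - t)] at [z = t e^{-t}]. Only [x = 0] is
    needed in the end; the free [x] makes an induction on [K] possible. *)
Definition abel_poly (R : realType) (z : R) (K : nat) : {poly R} :=
  \sum_(k < K.+1) (z ^+ k / k`!%:R) *: ('X + k%:R%:P) ^+ k.

Lemma abel_poly0 (R : realType) (z : R) : abel_poly z 0 = 1.
Proof.
by rewrite /abel_poly big_ord1 !expr0 fact0 divr1 scale1r.
Qed.

Lemma horner_abel_poly (R : realType) (z : R) (K : nat) (x : R) :
  (abel_poly z K).[x] = \sum_(k < K.+1) z ^+ k / k`!%:R * (x + k%:R) ^+ k.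
Proof.
rewrite /abel_poly horner_sum; apply: eq_bigr => k _.
by rewrite hornerZ horner_exp hornerD hornerX hornerC.
Qed.

Lemma deriv_abel_poly (R : realType) (z : R) (K : nat) (x : R) :
  ((abel_poly z K.+1)^`()).[x] = z * (abel_poly z K).[x + 1].
Proof.
rewrite horner_abel_poly /abel_poly raddf_sum horner_sum big_ord_recl /=.
rewrite expr0 derivZ derivC scaler0 hornerC add0r big_distrr /=.
apply: eq_bigr => k _; rewrite /bump leq0n add1n.
rewrite derivZ hornerZ deriv_exp derivD derivX derivC addr0 mul1r /=.
rewrite hornerMn horner_exp hornerD hornerX hornerC.
have -> : x + k.+1%:R = x + 1 + k%:R by rewrite -nat1r addrA.
rewrite exprS factS natrM -[X in _ * X = _]mulr_natr.
have : (k.+1%:R : R) != 0 by rewrite pnatr_eq0.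
have : (k`!%:R : R) != 0 by rewrite pnatr_eq0 -lt0n fact_gt0.
move: (k.+1%:R : R) (k`!%:R : R) ((x + 1 + k%:R) ^+ k) (z ^+ k) => A B C D A0 B0.
by field; rewrite A0 B0.
Qed.

Lemma abel_poly_at0 (R : realType) (z : R) (K : nat) :
  (abel_poly z K.+1).[0] = 1 + z * (abel_poly z K).[1].
Proof.
rewrite !horner_abel_poly big_ord_recl /= !expr0 fact0 divr1 mulr1.
congr (_ + _); rewrite big_distrr /=.
apply: eq_bigr => k _; rewrite /bump leq0n add1n add0r.
rewrite nat1r !exprS factS natrM.
have : (k.+1%:R : R) != 0 by rewrite pnatr_eq0.
have : (k`!%:R : R) != 0 by rewrite pnatr_eq0 -lt0n fact_gt0.
move: (k.+1%:R : R) (k`!%:R : R) (z ^+ k) => A B C A0 B0.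
by field; rewrite A0 B0.
Qed.

(* With [z = t e^{-t}], the bound [G x = e^{tx} / (1 - t)] satisfies the same
   relations [G' x = z G (x + 1)] and [G 0 = 1 + z G 1] as the [abel_poly]s. *)
Lemma abel_poly_le (R : realType) (t : R) (K : nat) (x : R) :
  0 < t < 1 -> 0 <= x ->
  (abel_poly (t * expR (- t)) K).[x] <= (1 - t)^-1 * expR (t * x).
Proof.
move=> /andP[t0 t1]; set z := t * expR (- t).
have z0 : 0 <= z by rewrite mulr_ge0 ?expR_ge0 ?ltW.
have c0 : 0 < (1 - t)^-1 by rewrite invr_gt0 subr_gt0.
have c1 : 1 <= (1 - t)^-1 by rewrite invf_ge1 ?subr_gt0 ?lerBlDr ?lerDl ?ltW.
elim: K x => [|K IH] x x0.
  rewrite abel_poly0 hornerC -[X in X <= _]mulr1; apply: ler_pM => //.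
  by rewrite -[X in X <= _]expR0 ler_expR mulr_ge0// ltW.
(* The gap between bound and polynomial: the induction hypothesis at [y + 1] makes its derivative
   nonnegative, and at 1 it gives [0 <= f 0]. *)
pose f := fun y : R => (1 - t)^-1 * expR (t * y) - (abel_poly z K.+1).[y].
have df (y : R) : is_derive y (1 : R) f ((1 - t)^-1 * (t * expR (t * y))
                             - z * (abel_poly z K).[y + 1]).
  rewrite -deriv_abel_poly.
  have dt : is_derive y (1 : R) (t \*: (id : R -> R)) (t *: (1 : R)).
    exact: is_deriveZ.
  have de := is_derive1_comp (is_derive_expR _) dt.
  have := is_deriveB (is_deriveZ (1 - t)^-1 de) (is_derive_poly (abel_poly z K.+1) y).
  by rewrite /GRing.scale /= mulr1 [_ * t]mulrC.
suff : f 0 <= f x.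
  rewrite /f mulr0 expR0 mulr1 => h; rewrite -subr_ge0 (le_trans _ h)//.
  rewrite subr_ge0 abel_poly_at0.
  have := IH 1 ler01; rewrite mulr1 => /(ler_wpM2l z0) h1.
  apply: (le_trans (lerD (lexx 1) h1)).
  rewrite /z mulrACA -expRD addNr expR0 mulr1.
  suff -> : 1 + t * (1 - t)^-1 = (1 - t)^-1 by [].
  have : 1 - t != 0 by rewrite subr_eq0 gt_eqF.
  by move=> ?; field.
apply: (@ger0_derive1_ndecry _ f 0) => //.
- move=> y; rewrite in_itv /= andbT => y0.
  rewrite derive1E; have [_ ->] := df y.
  rewrite subr_ge0.
  have y1 : 0 <= y + 1 by rewrite addr_ge0 ?ltW.
  apply: (le_trans (ler_wpM2l z0 (IH _ y1))).
  rewrite mulrDr mulr1 expRD /z.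
  have e : expR (- t) * expR t = 1 by rewrite -expRD addNr expR0.
  have -> : t * expR (- t) * ((1 - t)^-1 * (expR (t * y) * expR t)) =
     (1 - t)^-1 * (t * expR (t * y)) * (expR (- t) * expR t).
     by ring.
  by rewrite e mulr1.
- apply: continuous_subspaceT => y; apply: differentiable_continuous.
  by apply/derivable1_diffP; have [] := df y.
Qed.

Lemma abel_sum_le (R : realType) (t : R) (K : nat) :
  0 < t < 1 ->
  \sum_(k < K.+1) (k ^ k)%:R / k`!%:R * (t * expR (- t)) ^+ k <= (1 - t)^-1.
Proof.
move=> t01; have := @abel_poly_le _ t K 0 t01 (lexx 0).
rewrite mulr0 expR0 mulr1 horner_abel_poly; congr (_ <= _).
by apply: eq_bigr => k _; rewrite add0r natrX mulrC mulrCA mulrC -mulrA.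
Qed.

(** * Factorials and maximum likelihood *)

Lemma ln_le_subr1 (R : realType) (x : R) : 0 < x -> ln x <= x - 1.
Proof.
move=> x0; have := @le_ln1Dx R (x - 1); rewrite [1 + _]addrC subrK.
by apply; rewrite -subr_gt0 opprK subrK.
Qed.

(** This is [n! <= e n (n / e)^n]. Passing from [m] to [m + 1] needs
    [(m + 1) ln (m / (m + 1)) <= -1], an instance of [ln y <= y - 1]. *)
Lemma ln_fact_le (R : realType) (n : nat) : (0 < n)%N ->
  ln (n`!%:R : R) <= 1 + ln (n%:R) + n%:R * ln (n%:R) - n%:R.
Proof.
case: n => // n _; elim: n => [|n IH].
  by rewrite factS fact0 muln1 ln1 mulr0 !addr0 subrr.
have n1 : (0 : R) < n.+1%:R by rewrite ltr0n.
have n2 : (0 : R) < n.+2%:R by rewrite ltr0n.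
rewrite factS natrM lnM ?posrE ?ltr0n ?fact_gt0 //.
have h : n.+2%:R * (ln (n.+1%:R : R) - ln (n.+2%:R)) <= -1.
  rewrite -ln_div ?posrE // mulrC -ler_pdivlMr //.
  apply: le_trans (ln_le_subr1 _) _; first by rewrite divr_gt0.
  rewrite -[X in _ - X](divff (lt0r_neq0 n2)) -mulrBl.
  by rewrite -[n.+2%:R in X in X / _]nat1r opprD addrCA subrr addr0.
have e : (n.+2%:R : R) = 1 + n.+1%:R by rewrite nat1r.
move: IH h; rewrite e.
move: (ln (n.+1)`!%:R) (ln n.+1%:R) (ln (1 + n.+1%:R)) => A B C.
lra.
Qed.

Lemma iid_distr (R : realType) (T : finType) n (P : T -> R) :
  distr P -> distr (iid (n:=n) P).
Proof.
case=> P0 P1; split=> [x|]; first by apply: prodr_ge0.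
rewrite /iid -(bigA_distr_bigA (fun (_ : 'I_n) t => P t)) /=.
by apply: big1 => i _.
Qed.

(* The likelihood of [x] under its own empirical distribution. *)
Definition max_lik (R : realType) (T : finType) n (x : {ffun 'I_n -> T}) : R :=
  \prod_(j < n) ((count_of x (x j))%:R / n%:R).

Lemma count_of_gt0 (T : finType) n (x : {ffun 'I_n -> T}) j :
  (0 < count_of x (x j))%N.
Proof. by rewrite /count_of (bigD1 j) //= eqxx. Qed.

Lemma max_lik_gt0 (R : realType) (T : finType) n (x : {ffun 'I_n -> T}) :
  0 < max_lik R x.
Proof.
apply: prodr_gt0 => j _; rewrite divr_gt0 // ltr0n ?count_of_gt0 //.
exact: leq_ltn_trans (ltn_ord j).
Qed.

(** For the ratios [y j] of the two factors at position [j], [y <= e^{y - 1}] bounds their product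
    by [exp (\sum_j (y j - 1))]. The positions carrying letter [i] contribute [n * P i] to the sum
    of the [y j], or 0 if [i] is absent, so that sum is at most [n]. *)
Lemma iid_le_max_lik (R : realType) (T : finType) n (P : T -> R)
    (x : {ffun 'I_n -> T}) : distr P -> iid P x <= max_lik R x.
Proof.
move=> [P0 P1].
pose y (j : 'I_n) := P (x j) / ((count_of x (x j))%:R / n%:R).
have fpos (j : 'I_n) : (0 : R) < (count_of x (x j))%:R / n%:R.
  rewrite divr_gt0 // ltr0n ?count_of_gt0 //.
  exact: leq_ltn_trans (ltn_ord j).
suff y1 : \prod_j y j <= 1.
  rewrite /iid -[leRHS]mul1r -ler_pdivrMr ?max_lik_gt0 //.
  by rewrite /max_lik -prodf_div.
apply: (@le_trans _ _ (expR (\sum_j (y j - 1)))).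
  rewrite expR_sum; apply: ler_prod => j _.
  rewrite divr_ge0 ?(ltW (fpos j)) //=.
  by apply: le_trans (expR_ge1Dx _); rewrite addrC subrK.
rewrite -[leRHS]expR0 ler_expR sumrB sumr_const card_ord subr_le0.
have -> : \sum_j y j = \sum_i \sum_(j | x j == i) P i * n%:R / (count_of x i)%:R.
  rewrite (partition_big x predT) //=; apply: eq_bigr => i _.
  by apply: eq_bigr => j /eqP <-; rewrite /y invf_div mulrA.
apply: (@le_trans _ _ (\sum_i P i * n%:R)); last by rewrite -big_distrl /= P1 mul1r.
apply: ler_sum => i _; rewrite sumr_const.
have -> : #|[pred j | x j == i]| = count_of x i.
  by rewrite -sum1_card big_mkcond.
case: (count_of x i) => [|c]; first by rewrite mulr0n mulr_ge0.
by rewrite -[X in X <= _]mulr_natr divfK // pnatr_eq0.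
Qed.

(** Letters absent from [x] enter the product through [0 ^ 0 = 1]. *)
Lemma max_lik_count (R : realType) (T : finType) n (x : {ffun 'I_n -> T}) :
  max_lik R x = (\prod_i (count_of x i ^ count_of x i)%:R) / n%:R ^+ n.
Proof.
rewrite /max_lik prodf_div prodr_const card_ord; congr (_ / _).
by rewrite (prod_count_of (fun i => (count_of x i)%:R)); apply: eq_bigr => i _; rewrite natrX.
Qed.

Lemma sum_max_lik_le (R : realType) (S n : nat) (t : R) :
  (0 < n)%N -> 0 < t < 1 ->
  \sum_(x : {ffun 'I_n -> 'I_S}) max_lik R x <=
  n`!%:R / n%:R ^+ n / (t * expR (- t)) ^+ n * (1 - t)^-1 ^+ S.
Proof.
move=> n0 t01; have /andP[t0 t1] := t01.
have z0 : 0 < t * expR (- t) by rewrite mulr_gt0 ?expR_gt0.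
have nn : (0 : R) < n%:R ^+ n by rewrite exprn_gt0 // ltr0n.
under eq_bigr do rewrite max_lik_count.
rewrite -big_distrl /= ler_pdivrMr //.
have -> : n`!%:R / n%:R ^+ n / (t * expR (- t)) ^+ n * (1 - t)^-1 ^+ S * n%:R ^+ n
   = (n`!%:R * (1 - t)^-1 ^+ S) / (t * expR (- t)) ^+ n.
  by rewrite mulrAC [X in X * n%:R ^+ n]mulrAC divfK ?gt_eqF // mulrAC.
rewrite ler_pdivlMr ?exprn_gt0 //.
apply: le_trans (@sum_prod_count_le R 'I_S n (fun _ k => (k ^ k)%:R) _ _ (ltW z0)) _ => //.
rewrite ler_pM2l ?ltr0n ?fact_gt0 // -[X in _ <= _ ^+ X]card_ord -prodr_const.
apply: ler_prod => i _; rewrite abel_sum_le // andbT.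
by apply: sumr_ge0 => k _; rewrite mulr_ge0 ?exprn_ge0 ?divr_ge0 // ltW.
Qed.

Lemma ln2_gt0 (R : realType) : (0 : R) < ln 2.
Proof. by rewrite ln_gt0 // ltr1n. Qed.

Lemma lg_le (R : realType) (x y : R) : 0 < x -> x <= y -> lg x <= lg y.
Proof.
move=> x0 xy; rewrite /lg ler_pM2r ?invr_gt0 ?ln2_gt0 //.
by rewrite ler_ln // posrE (lt_le_trans x0).
Qed.

(** The parameter [t] stays free here; it is optimised once [S / n] has a limit. *)
Lemma minimax_red_le (R : realType) (S n : nat) (t : R) :
  (0 < S)%N -> (0 < n)%N -> 0 < t < 1 ->
  (minimax_red R S n <= (n%:R^-1 * (1 + ln n%:R - n%:R
     - n%:R * (ln t - t) - S%:R * ln (1 - t)) / ln 2)%:E)%E.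
Proof.
move=> S0 n0 t01; have /andP[t0 t1] := t01.
pose Z := \sum_(x : {ffun 'I_n -> 'I_S}) max_lik R x.
have Z0 : 0 < Z.
  (* One constant word, available since [0 < S], makes the Shtarkov sum positive. *)
  rewrite /Z (bigD1 [ffun => Ordinal S0]) //= ltr_pwDl ?max_lik_gt0 //.
  by apply: sumr_ge0 => x _; rewrite ltW ?max_lik_gt0.
have lnZ : ln Z <= 1 + ln n%:R - n%:R - n%:R * (ln t - t) - S%:R * ln (1 - t).
  have z0 : 0 < t * expR (- t) by rewrite mulr_gt0 ?expR_gt0.
  have nn : (0 : R) < n%:R ^+ n by rewrite exprn_gt0 // ltr0n.
  have t1' : 0 < 1 - t by rewrite subr_gt0.
  have h := sum_max_lik_le S n0 t01.
  have fp : (0 : R) < n`!%:R by rewrite ltr0n fact_gt0.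
  have : ln Z <= ln (n`!%:R / n%:R ^+ n / (t * expR (- t)) ^+ n * (1 - t)^-1 ^+ S).
    by rewrite ler_ln // posrE ?(lt_le_trans Z0).
  rewrite !(lnM, lnV, lnXn) ?posrE ?(invr_gt0, divr_gt0, mulr_gt0, exprn_gt0, expR_gt0, ltr0n, subr_gt0, fact_gt0) //.
  rewrite expRK; move=> /le_trans; apply.
  have := ln_fact_le R n0.
  rewrite -[ln _ *+ n]mulr_natl -[(_ + _) *+ n]mulr_natl -[- _ *+ S]mulr_natl.
  move: (ln (n`!%:R : R)) (ln (n%:R : R)) (ln t) (ln (1 - t)) (n%:R : R) (S%:R : R).
  move=> A B C D N s; lra.
have dQ : distr (fun x : {ffun 'I_n -> 'I_S} => max_lik R x / Z).
  split=> [x|]; first by rewrite divr_ge0 ?ltW ?max_lik_gt0.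
  by rewrite -big_distrl /= divff // gt_eqF.
rewrite /minimax_red; apply: ge_ereal_inf.
eexists; first by exists (fun x => max_lik R x / Z).
apply: ge_ereal_sup => _ [P dP <-].
have [I0 I1] := iid_distr n dP.
rewrite /KL ifT; last first.
  by apply/forallP => x; apply/implyP => _; rewrite divr_gt0 ?max_lik_gt0.
rewrite -EFinM lee_fin -mulrA ler_pM2l ?invr_gt0 ?ltr0n //.
apply: (@le_trans _ _ (lg Z)); last first.
  by rewrite /lg ler_pM2r ?invr_gt0 ?ln2_gt0.
(* Spreading [lg Z] over the total mass 1 of [iid P] reduces the claim to the pointwise bound
   [P / Q <= Z]. *)
rewrite -[lg Z]mul1r -I1 big_distrl /=.
apply: ler_sum => x _; case: ifP => Px; last first.
  have -> : iid P x = 0 by apply/eqP; rewrite eq_le I0 andbT leNgt Px.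
  by rewrite mul0r.
rewrite ler_pM2l //; apply: lg_le.
  by rewrite !divr_gt0 ?max_lik_gt0.
rewrite invf_div mulrA ler_pdivrMr ?max_lik_gt0 // mulrC.
by rewrite ler_pM2l ?iid_le_max_lik.
Qed.

(** * Lower bound *)

(* [V t x] acts as a decoder, the sub-probability of guessing [t] from [x]: this
   is Gibbs' inequality for [P t x / #|A|] against [Q x * V t x]. *)
Lemma capacity_le (R : realType) (T X : finType) (A : {set T}) (P V : T -> X -> R)
    (Q : X -> R) (b : R) :
  (0 < #|A|)%N -> (forall t, t \in A -> distr (P t)) -> distr Q ->
  (forall t x, 0 < V t x) -> (forall x, \sum_(t in A) V t x <= 1) ->
  (forall t, t \in A -> - b <= \sum_x P t x * ln (V t x)) ->
  exists2 t, t \in A & (((ln #|A|%:R - b) / ln 2)%:E <= KL (P t) Q)%E.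
Proof.
move=> A0 dP [Q0 Q1] V0 V1 hb; apply: contrapT => /forall2NP nKL.
have {}nKL t : t \in A -> (KL (P t) Q < ((ln #|A|%:R - b) / ln 2)%:E)%E.
  by move=> tA; have [|/negP] := nKL t; rewrite -?ltNge.
have M0 : (0 : R) < #|A|%:R by rewrite ltr0n.
pose M : R := #|A|%:R; rewrite -/M in M0.
pose D t := \sum_x (if 0 < P t x then P t x * ln (P t x / Q x) else 0).
have supp t x : t \in A -> 0 < P t x -> 0 < Q x.
  move=> /nKL; rewrite /KL; case: ifP => [/forallP/(_ x)/implyP //|_].
  by rewrite ltNge leey.
have Dlt t : t \in A -> D t < ln M - b.
  move=> tA; have := nKL _ tA; rewrite /KL ifT; last first.
    by apply/forallP => x; apply/implyP; exact: supp.
  rewrite lte_fin; set s := (X in X < _) => hs.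
  suff -> : D t = s * ln 2 by rewrite -ltr_pdivlMr ?ln2_gt0.
  rewrite /s big_distrl /=; apply: eq_bigr => x _.
  by case: ifP; rewrite ?mul0r // /lg mulrA divfK // gt_eqF ?ln2_gt0.
(* Termwise [ln r <= r - 1] with [r = M * Q x * V t x / P t x]. *)
have Dge t : t \in A -> ln M - b + 1 - M * \sum_x Q x * V t x <= D t.
  move=> tA; have [P0 P1] := dP _ tA.
  apply: (@le_trans _ _ (\sum_x (P t x * ln M + P t x * ln (V t x) + P t x
       - M * (Q x * V t x)))).
    rewrite sumrB !big_split /= -!big_distrl -big_distrr /= P1 mul1r lerB //.
    by rewrite lerD2r lerD2l hb.
  apply: ler_sum => x _; case: ifP => Px; last first.
    have -> : P t x = 0 by apply/eqP; rewrite eq_le P0 andbT leNgt Px.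
    rewrite !mul0r !add0r oppr_le0 mulr_ge0 ?(ltW M0) // mulr_ge0 //.
    exact: ltW.
  have Qx := supp _ _ tA Px; have Vx := V0 t x.
  have r0 : 0 < M * Q x * V t x / P t x by rewrite divr_gt0 ?mulr_gt0.
  have := ln_le_subr1 r0.
  rewrite !(lnM, lnV) ?posrE ?(invr_gt0, mulr_gt0, M0, Qx, Vx, Px) //.
  move=> /(ler_wpM2l (P0 x)).
  rewrite [X in _ <= X -> _]mulrBr [P t x * (_ / _)]mulrC divfK ?gt_eqF //.
  lra.
suff : M * (ln M - b) <= \sum_(t in A) D t.
  apply/negP; rewrite -ltNge /M mulr_natl -sumr_const.
  have /card_gt0P[t0 t0A] := A0.
  rewrite [X in X < _](bigD1 t0) //= [X in _ < X](bigD1 t0) //= ltr_leD ?Dlt //.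
  by apply: ler_sum => t /andP[tA _]; rewrite ltW ?Dlt.
apply: le_trans (ler_sum _ (fun t => Dge t)).
rewrite sumrB -mulr_sumr.
(* Summed over [A], the subtracted terms amount to at most [M], which the [M] summands 1
   compensate. *)
have h : \sum_(t in A) \sum_x Q x * V t x <= 1.
  rewrite exchange_big /= -[leRHS]Q1; apply: ler_sum => x _.
  by rewrite -mulr_sumr ler_piMr.
rewrite sumr_const -mulr_natl -/M.
have := ler_wpM2l (ltW M0) h; lra.
Qed.

(** * Moments of sums over independent letters *)

Lemma iid_cons (R : realType) (T : finType) n (P : T -> R) t (x : {ffun 'I_n -> T}) :
  iid P (ffun_cons t x) = P t * iid P x.
Proof.
rewrite /iid big_ord_recl ffun_cons0; congr (_ * _).
by apply: eq_bigr => i _; rewrite ffun_consS.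
Qed.

Lemma iid_mean_sum (R : realType) (T : finType) n (P f : T -> R) :
  distr P -> \sum_t P t * f t = 0 ->
  \sum_(x : {ffun 'I_n -> T}) iid P x * \sum_(j < n) f (x j) = 0.
Proof.
move=> dP f0; have [P0 P1] := dP; elim: n => [|n IH].
  by rewrite big1 // => x _; rewrite big_ord0 mulr0.
rewrite sum_ffun_cons.
under eq_bigr => t _.
  under eq_bigr => x _.
    rewrite iid_cons big_ord_recl ffun_cons0.
    under eq_bigr do rewrite ffun_consS.
    rewrite mulrDr [X in X + _]mulrAC -[X in _ + X]mulrA.
    over.
  rewrite big_split /= -!mulr_sumr IH mulr0 addr0 (iid_distr n dP).2 mulr1.
  over.
exact: f0.
Qed.

(** Splitting off the first letter, the cross term vanishes because the remaining sum is centred. *)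
Lemma iid_var_sum (R : realType) (T : finType) n (P f : T -> R) :
  distr P -> \sum_t P t * f t = 0 ->
  \sum_(x : {ffun 'I_n -> T}) iid P x * (\sum_(j < n) f (x j)) ^+ 2 =
    n%:R * \sum_t P t * f t ^+ 2.
Proof.
move=> dP f0; have [P0 P1] := dP; elim: n => [|n IH].
  by rewrite big1 ?mul0r // => x _; rewrite big_ord0 expr0n mulr0.
rewrite sum_ffun_cons.
pose g (x : {ffun 'I_n -> T}) := \sum_(j < n) f (x j).
rewrite -/g in IH.
have step t : \sum_(x : {ffun 'I_n -> T})
    iid P (ffun_cons t x) * (\sum_j f (ffun_cons t x j)) ^+ 2 =
    P t * f t ^+ 2 + P t * (n%:R * \sum_t P t * f t ^+ 2).
  transitivity (\sum_x (P t * f t ^+ 2 * iid P x + P t * f t *+ 2 * (iid P x * g x) +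
      P t * (iid P x * g x ^+ 2))).
    apply: eq_bigr => x _; rewrite iid_cons big_ord_recl ffun_cons0.
    under eq_bigr do rewrite ffun_consS.
    by rewrite -/(g x); ring.
  rewrite !big_split /= -!mulr_sumr IH iid_mean_sum // mulr0 addr0.
  by rewrite (iid_distr n dP).2 mulr1.
under eq_bigr do rewrite step.
by rewrite big_split /= -mulr_suml P1 mul1r -nat1r mulrDl mul1r.
Qed.

(** * Sums of Gaussian values *)

Lemma sum_gauss_fun_le (R : realType) (h : R) (J : nat) : 0 < h ->
  h * \sum_(j < J) gauss_fun (j.+1%:R * h) <= Num.sqrt pi / 2.
Proof.
move=> h0.
pose mu := @lebesgue_measure R.
(* The Gaussian decreases on the half-line, so rectangles with the height of their right endpoint
   lie below it. *)
have key : ((h * \sum_(j < J) gauss_fun (j.+1%:R * h))%:E <=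
    \int[mu]_(x in `[0%R, (J%:R * h)%R[) (gauss_fun x)%:E)%E.
  elim: J => [|J IH].
    rewrite big_ord0 mulr0; apply: integral_ge0 => x _.
    by rewrite lee_fin gauss_fun_ge0.
  have J0 : 0 <= J%:R * h by rewrite mulr_ge0 // ltW.
  have JJ : J%:R * h <= J.+1%:R * h by rewrite ler_pM2r // ler_nat.
  rewrite big_ord_recr /= mulrDr EFinD.
  have -> : `[0%R, J.+1%:R * h[%classic =
      (`[0%R, J%:R * h[ `|` `[J%:R * h, J.+1%:R * h[)%classic.
    rewrite -itv_bndbnd_setU ?bnd_simp //.
  rewrite ge0_integral_setU //=; first last.
  - apply/disj_setPS => x [] /=; rewrite !in_itv /= => /andP[_ a] /andP[b _].
    by move: (lt_le_trans a b); rewrite ltxx.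
  - by move=> x _; rewrite lee_fin gauss_fun_ge0.
  - by apply/measurable_EFinP; apply: measurable_funTS; exact: measurable_gauss_fun.
  apply: leeD => //.
  have -> : (h * gauss_fun (J.+1%:R * h))%:E =
     (\int[mu]_(x in `[(J%:R * h)%R, (J.+1%:R * h)%R[) (cst (gauss_fun (J.+1%:R * h)%R)%:E) x)%E.
    rewrite integral_cst //= lebesgue_measure_itv /= lte_fin ltr_pM2r // ltr_nat ltnSn.
    by rewrite -EFinD -mulrBl -natrB // subSnn mul1r -EFinM mulrC.
  apply: ge0_le_integral => //=.
  - by move=> x _; rewrite lee_fin gauss_fun_ge0.
  - by apply/measurable_EFinP; apply: measurable_funTS; exact: measurable_gauss_fun.
  - move=> x; rewrite in_itv /= => /andP[a b].
    have x0 := le_trans J0 a.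
    rewrite lee_fin /gauss_fun ler_expR lerN2 ler_sqr ?nnegrE ?(ltW b) //.
    exact: le_trans JJ.
rewrite -lee_fin; apply: (le_trans key).
rewrite -integral0y_gauss; apply: ge0_subset_integral => //=.
- by apply/measurable_EFinP; apply: measurable_funTS; exact: measurable_gauss_fun.
- by move=> x _; rewrite lee_fin gauss_fun_ge0.
- by move=> x /=; rewrite !in_itv /= andbT => /andP[].
Qed.

(** Each side of the centre [c] is at most half the Gaussian integral; the extra 1 is the term
    [m = c]. *)
Lemma sum_gauss_shift_le (R : realType) (s : R) (c N : nat) : 0 < s ->
  \sum_(m < N) expR (- (m%:R - c%:R) ^+ 2 / (2 * s)) <= Num.sqrt (2 * pi * s) + 1.
Proof.
move=> s0; pose h : R := (Num.sqrt (2 * s))^-1.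
have s20 : 0 < 2 * s by rewrite mulr_gt0.
have h0 : 0 < h by rewrite invr_gt0 sqrtr_gt0.
have eh (d : R) : expR (- d ^+ 2 / (2 * s)) = gauss_fun (d * h).
  by rewrite /gauss_fun exprMn /h exprVn sqr_sqrtr ?mulNr // ltW.
have half J : \sum_(j < J) gauss_fun (j.+1%:R * h) <= Num.sqrt (2 * pi * s) / 2.
  have := sum_gauss_fun_le J h0; rewrite mulrC -ler_pdivlMr // /h invrK.
  by rewrite mulrAC -sqrtrM ?pi_ge0 // mulrCA mulrA.
(* Extending the range to [c + N] allows the split at [c] even when [N <= c]. *)
apply: (@le_trans _ _ (\sum_(m < c + N) gauss_fun ((m%:R - c%:R) * h))).
  under eq_bigr do rewrite eh.
  rewrite -!(big_mkord predT (fun m => gauss_fun ((m%:R - c%:R) * h))).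
  rewrite (@big_cat_nat _ _ _ N 0 (c + N)%N) ?leq_addl //= lerDl.
  by apply: sumr_ge0 => m _; rewrite gauss_fun_ge0.
rewrite big_split_ord /=.
have -> : Num.sqrt (2 * pi * s) + 1 =
  Num.sqrt (2 * pi * s) / 2 + (1 + Num.sqrt (2 * pi * s) / 2) by field.
apply: lerD.
  apply: le_trans (half c); rewrite (reindex_inj rev_ord_inj) /=.
  apply: ler_sum => m _; rewrite natrB ?ltn_ord // addrAC subrr add0r mulNr.
  by rewrite /gauss_fun sqrrN.
case: N => [|N].
  by rewrite big_ord0 addr_ge0 // divr_ge0 ?sqrtr_ge0.
rewrite big_ord_recl /= addn0 subrr mul0r lerD ?gauss_fun_le1 //.
apply: le_trans (half N); apply: ler_sum => m _.
by rewrite natrD addrAC subrr add0r.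
Qed.

(** * Comparing upper and lower limits with a convergent sequence *)

Lemma limn_esup_le_lim (R : realType) (u : (\bar R)^nat) (v : R^nat) (l : R) :
  (\forall n \near \oo, (u n <= (v n)%:E)%E) -> v @ \oo --> l ->
  (limn_esup u <= l%:E)%E.
Proof.
move=> uv vl; apply/lee_addgt0Pr => e e0.
rewrite /limn_esup limf_esupE; apply: ge_ereal_inf.
exists (ereal_sup [set u n | n in [set n | (u n <= (l + e)%:E)%E]]).
  exists [set n | (u n <= (l + e)%:E)%E] => //=.
  near=> n; have h1 : (u n <= (v n)%:E)%E by near: n.
  apply: (le_trans h1); rewrite lee_fin -lerBlDl.
  apply: le_trans (ler_norm _) _; rewrite distrC.
  by near: n; move/cvgrPdist_le : vl; exact.
by apply: ge_ereal_sup => _ [n /= h <-]; rewrite -EFinD.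
Unshelve. all: by end_near. Qed.

Lemma limn_einf_ge_lim (R : realType) (u : (\bar R)^nat) (v : R^nat) (l : R) :
  (\forall n \near \oo, ((v n)%:E <= u n)%E) -> v @ \oo --> l ->
  (l%:E <= limn_einf u)%E.
Proof.
move=> uv vl; rewrite /limn_einf leeNr.
apply: (@limn_esup_le_lim _ _ (fun n => - v n)); last exact: cvgN.
by apply: filterS uv => n h; rewrite EFinN leeN2.
Qed.

(* A composition [m] of [N = L n] into [S] parts is the parameter [m / N]; its
   Gaussian decoder is centred at [L * count_of x]. *)
Lemma minimax_red_ge (R : realType) (s n L : nat) :
  (0 < n)%N -> (0 < L)%N ->
  ((n%:R^-1 * (ln ('C(s + n * L, s))%:R - s.+1%:R / 2
      - s.+1%:R * ln (Num.sqrt (2 * pi * (n%:R * L%:R ^+ 2 / s.+1%:R)) + 1)) / ln 2)%:E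
     <= minimax_red R s.+1 n)%E.
Proof.
move=> n0 L0.
(* The coordinate errors have total mean square at most [n L^2]; [v] is its share per coordinate, so
   the mean exponent costs at most [s.+1 / 2]. [G] dominates the mass of each discretised
   Gaussian. *)
set v := n%:R * L%:R ^+ 2 / s.+1%:R; set G := Num.sqrt _ + 1.
have nR : (0 : R) < n%:R by rewrite ltr0n.
have LR : (0 : R) < L%:R by rewrite ltr0n.
have v0 : 0 < v by rewrite divr_gt0 ?mulr_gt0 ?exprn_gt0 ?ltr0n.
have G0 : 0 < G by rewrite ltr_wpDl ?sqrtr_ge0.
have NL0 : (0 : R) < (n * L)%:R by rewrite ltr0n muln_gt0 n0.
rewrite /minimax_red; apply: le_ereal_inf_tmp => _ [Q dQ <-].
pose T := (s.+1).-tuple 'I_(n * L).+1.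
pose A := [set t : T | \sum_(i <- t) i == n * L]%N%SET.
pose P (t : T) (i : 'I_s.+1) : R := (tnth t i)%:R / (n * L)%:R.
pose V (t : T) (x : {ffun 'I_n -> 'I_s.+1}) : R :=
  \prod_i (expR (- ((tnth t i)%:R - (L * count_of x i)%:R) ^+ 2 / (2 * v)) / G).
have dP t : t \in A -> distr (P t).
  rewrite finset.inE big_tuple => /eqP tA; split=> [i|]; first by rewrite divr_ge0.
  by rewrite -big_distrl /= -natr_sum tA divff ?gt_eqF.
have V0 t x : 0 < V t x by apply: prodr_gt0 => i _; rewrite divr_gt0 ?expR_gt0.
have V1 x : \sum_(t in A) V t x <= 1.
  (* Dropping the constraint on the sum of the parts lets the total mass factor over coordinates. *)
  apply: (@le_trans _ _ (\sum_(t : T) V t x)).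
    by rewrite [leRHS](bigID (mem A)) /= lerDl sumr_ge0 // => t _; exact: ltW.
  rewrite (reindex (fun f : {ffun 'I_s.+1 -> 'I_(n * L).+1} => [tuple f i | i < s.+1])) /=; last first.
    exists (fun t : T => [ffun i => tnth t i]) => [f _|t _].
      by apply/ffunP => i; rewrite ffunE tnth_mktuple.
    by apply/eq_from_tnth => i; rewrite tnth_mktuple ffunE.
  rewrite /V; under eq_bigr do under eq_bigr do rewrite tnth_mktuple.
  rewrite -(bigA_distr_bigA (fun i (m : 'I_(n * L).+1) =>
    expR (- (m%:R - (L * count_of x i)%:R) ^+ 2 / (2 * v)) / G)) /=.
  apply: (@le_trans _ _ (\prod_(i < s.+1) 1)); last by rewrite big1_eq.
  apply: ler_prod => i _; apply/andP; split.
    by apply: sumr_ge0 => m _; rewrite divr_ge0 ?expR_ge0 ?ltW.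
  by rewrite -mulr_suml ler_pdivrMr // mul1r sum_gauss_shift_le.
have card : #|A| = 'C(s + n * L, s) by rewrite card_ord_partitions.
have hb t : t \in A ->
    - (s.+1%:R / 2 + s.+1%:R * ln G) <= \sum_x iid (P t) x * ln (V t x).
  move=> tA; have dPt := dP t tA; have [I0 I1] := iid_distr n dPt.
  have lnVE x : ln (V t x) = - (\sum_i ((tnth t i)%:R - (L * count_of x i)%:R) ^+ 2) / (2 * v)
      - s.+1%:R * ln G.
    rewrite /V prodf_div -expR_sum prodr_const card_ord.
    rewrite lnM ?posrE ?expR_gt0 ?invr_gt0 ?exprn_gt0 // lnV ?posrE ?exprn_gt0 //.
    by rewrite expRK lnXn // -mulr_suml sumrN [s.+1%:R * _]mulr_natl.
  under eq_bigr do rewrite lnVE mulrBr mulrA.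
  rewrite sumrB -!mulr_suml I1 mul1r opprD lerD2r.
  under eq_bigr do rewrite mulrN mulr_sumr.
  rewrite sumrN mulNr lerN2 exchange_big /=.
  rewrite ler_pdivrMr ?mulr_gt0 //.
  have -> : s.+1%:R / 2 * (2 * v) = n%:R * L%:R ^+ 2.
    by rewrite mulrA divfK // mulrC /v divfK.
  apply: (@le_trans _ _ (\sum_i n%:R * L%:R ^+ 2 * P t i)); last first.
    by rewrite -mulr_sumr dPt.2 mulr1.
  apply: ler_sum => i _.
  (* Centred indicator of letter [i] up to sign: over a word it sums to [n * P t i] minus the count,
     and its variance [p (1 - p)] is at most [p = P t i]. *)
  pose f (k : 'I_s.+1) := P t i - (k == i)%:R.
  have Pf : \sum_k P t k * f k = 0.
    under eq_bigr do rewrite mulrBr.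
    rewrite sumrB -mulr_suml dPt.2 mul1r (bigD1 i) //= eqxx mulr1 big1 ?addr0 ?subrr //.
    by move=> k /negbTE ->; rewrite mulr0.
  have Pf2 : \sum_k P t k * f k ^+ 2 <= P t i.
    have fE k : P t k * f k ^+ 2 = P t k * f k * P t i - P t k * f k * (k == i)%:R.
      by rewrite expr2 mulrA -mulrBr.
    under eq_bigr do rewrite fE.
    rewrite sumrB -mulr_suml Pf mul0r sub0r (bigD1 i) //= eqxx mulr1 big1 ?addr0; last first.
      by move=> k /negbTE ->; rewrite mulr0.
    by rewrite /f eqxx mulrBr mulr1 opprB lerBlDr lerDl -expr2 sqr_ge0.
  have -> : \sum_(x : {ffun 'I_n -> 'I_s.+1}) iid (P t) x * ((tnth t i)%:R - (L * count_of x i)%:R) ^+ 2 =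
     L%:R ^+ 2 * \sum_(x : {ffun 'I_n -> 'I_s.+1}) iid (P t) x * (\sum_(j < n) f (x j)) ^+ 2.
    rewrite mulr_sumr; apply: eq_bigr => x _.
    have -> : \sum_(j < n) f (x j) = n%:R * P t i - (count_of x i)%:R.
      by rewrite /f sumrB sumr_const card_ord mulr_natl /count_of natr_sum.
    have -> : (tnth t i)%:R = (n%:R * L%:R) * P t i :> R.
      by rewrite /P -natrM mulrC divfK ?gt_eqF.
    by rewrite natrM; ring.
  rewrite iid_var_sum // mulrCA mulrA ler_pM2l // mulr_gt0 // exprn_gt0 //.
have A0 : (0 < #|A|)%N by rewrite card bin_gt0 leq_addr.
have [t tA ht] := capacity_le A0 (fun t tA => iid_distr n (dP t tA)) dQ V0 V1 hb.
apply: le_ereal_sup_tmp; exists ((n%:R^-1)%:E * KL (iid (n:=n) (P t)) Q)%E.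
  by exists (P t) => //; exact: dP.
rewrite -mulrA EFinM lee_pmul2l ?lte_fin ?invr_gt0 //.
by move: ht; rewrite card opprD addrA.
Qed.

(** * Asymptotics *)

Lemma ln_sqrt (R : realType) (x : R) : 0 < x -> ln (Num.sqrt x) = ln x / 2.
Proof.
move=> x0; apply: (@mulIf _ 2) => //.
by rewrite divfK // mulr_natr -lnXn ?sqrtr_gt0 // sqr_sqrtr // ltW.
Qed.

Lemma cvg_invn (R : realType) : (fun n => n%:R^-1 : R) @ \oo --> (0 : R).
Proof. by rewrite -cvg_shiftS; exact: cvg_harmonic. Qed.

(** Since [ln n = 2 ln (sqrt n) <= 2 sqrt n], the quotient is at most [2 / sqrt n]. *)
Lemma cvg_ln_divn (R : realType) : (fun n => ln (n%:R : R) / n%:R) @ \oo --> (0 : R).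
Proof.
apply: (@squeeze_cvgr _ _ _ _ (fun=> 0) (fun n => 2 * Num.sqrt (n%:R^-1 : R))).
- near=> n; have n0 : (0 < n)%N by near: n; exists 1%N.
  have nR : (0 : R) < n%:R by rewrite ltr0n.
  rewrite divr_ge0 ?ln_ge0 ?ler1n //= ler_pdivrMr // -mulrA sqrtrV //.
  have -> : (Num.sqrt (n%:R : R))^-1 * n%:R = Num.sqrt n%:R.
    rewrite -[X in _ * X](sqr_sqrtr (ler0n R n)) expr2 mulrA mulVf ?mul1r //.
    by rewrite gt_eqF ?sqrtr_gt0.
  rewrite mulrC -ler_pdivrMr // -ln_sqrt //.
  by apply/ltW; apply: ln_sublinear; rewrite sqrtr_gt0.
- exact: cvg_cst.
- rewrite -[X in _ --> X](mulr0 2) -[X in 2 * X](@sqrtr0 R).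
  apply: cvgMl_tmp; apply: continuous_cvg; first exact: sqrt_continuous.
  exact: cvg_invn.
Unshelve. all: by end_near. Qed.

(** Each of the [s] factors of [s! * 'C(s + N, s)] is at least [N]. Multiplying by [s + 1] turns
    [s!] into [(s + 1)!], so the factorial bound applies even for [s = 0], and its term [ln (s + 1)]
    cancels. *)
Lemma ln_bin_ge (R : realType) (s N : nat) : (0 < N)%N ->
  s.+1%:R * ln (N%:R : R) - ln N%:R - 1 - s.+1%:R * ln s.+1%:R + s.+1%:R
    <= ln ('C(s + N, s))%:R.
Proof.
move=> N0; have NR : (0 : R) < N%:R by rewrite ltr0n.
have h : (N ^ s <= 'C(s + N, s) * s`!)%N.
  rewrite bin_ffact ffact_prod -[X in (_ ^ X <= _)%N]card_ord -prod_nat_const.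
  by apply: leq_prod => i _; rewrite -addnBAC ?leq_addl // ltnW.
have C0 : (0 < 'C(s + N, s))%N by rewrite bin_gt0 leq_addr.
have /(ler_wpM2l (ler0n R s.+1)) {}h : (N%:R ^+ s : R) <= ('C(s + N, s))%:R * s`!%:R.
  by rewrite -natrX -natrM ler_nat.
have : ln (s.+1%:R * N%:R ^+ s) <= ln (('C(s + N, s))%:R * (s.+1)`!%:R : R).
  rewrite ler_ln ?posrE ?mulr_gt0 ?exprn_gt0 ?ltr0n ?fact_gt0 //.
  by apply: le_trans h _; rewrite factS natrM mulrCA.
rewrite !lnM ?posrE ?exprn_gt0 ?ltr0n ?fact_gt0 // lnXn // -[ln _ *+ s]mulr_natl.
have := @ln_fact_le R _ (ltn0Sn s).
have sE : s.+1%:R = 1 + s%:R :> R by rewrite nat1r.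
rewrite sE; move: (ln ((s.+1)`!%:R : R)) (ln (1 + s%:R : R)) (ln (N%:R : R)) => A B D.
move: (ln ('C(s + N, s)%:R : R)) (s%:R : R) => E S; lra.
Qed.

Lemma C_alpha_gt1 (R : realType) (a : R) : 0 < a -> 1 < C_alpha a.
Proof.
move=> a0; have : 1 < Num.sqrt (1 + 4 / a).
  by rewrite -[ltLHS]sqrtr1 ltr_sqrt ?addr_gt0 ?divr_gt0 // ltrDl divr_gt0.
rewrite /C_alpha; lra.
Qed.

(** Stationarity condition for the upper bound: the minimiser of [t - ln t - a ln (1 - t)] satisfies
    [(1 - t)^2 = a t], which becomes this equation for [t = 1 - 1 / C_alpha a]. *)
Lemma C_alphaE (R : realType) (a : R) : 0 < a ->
  a * C_alpha a * (C_alpha a - 1) = 1.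
Proof.
move=> a0; have a1 : a != 0 by rewrite gt_eqF.
have e : Num.sqrt (1 + 4 / a) ^+ 2 = 1 + 4 / a.
  by rewrite sqr_sqrtr // addr_ge0 // divr_ge0 // ltW.
have -> : a * C_alpha a * (C_alpha a - 1) = a / 4 * (Num.sqrt (1 + 4 / a) ^+ 2 - 1).
  by rewrite /C_alpha; field.
by rewrite e; field.
Qed.

Lemma minimax_red_limsup_le (R : realType) (a : R) (S : nat -> nat) : 0 < a ->
  (fun n => (S n)%:R / n%:R : R) @ \oo --> a ->
  (limn_esup (fun n => minimax_red R (S n) n) <= (lg (B_alpha a))%:E)%E.
Proof.
move=> a0 hS; set c := C_alpha a.
have c1 : 1 < c by exact: C_alpha_gt1.
have c0 : 0 < c by apply: lt_trans c1.
have cE : a * c * (c - 1) = 1 by exact: C_alphaE.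
pose t := 1 - c^-1.
have ci0 : 0 < c^-1 by rewrite invr_gt0.
have ci1 : c^-1 < 1 by rewrite invf_lt1.
have t0 : 0 < t by rewrite subr_gt0.
have t1 : t < 1 by rewrite gtrDl oppr_lt0.
have ln1t : ln (1 - t) = - ln c by rewrite /t opprB addrC subrK lnV.
have lnt : ln t = - ln a - 2 * ln c.
  (* By [cE], [c - 1 = 1 / (a c)]; divide by [c]. *)
  have -> : t = (a * c ^+ 2)^-1.
    have a1 : a != 0 by rewrite gt_eqF.
    have c2 : c != 0 by rewrite gt_eqF.
    apply: (@mulfI _ (a * c ^+ 2)); first by rewrite mulf_neq0 ?expf_neq0.
    by rewrite divff ?mulf_neq0 ?expf_neq0 // -cE /t; field.
  rewrite lnV ?posrE ?mulr_gt0 ?exprn_gt0 // lnM ?posrE ?exprn_gt0 // lnXn //.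
  by rewrite -[ln c *+ 2]mulr_natl opprD.
pose v (n : nat) := (n%:R^-1 + ln n%:R / n%:R - 1 - (ln t - t)
  - (S n)%:R / n%:R * ln (1 - t)) / ln 2.
have -> : lg (B_alpha a) = (0 + 0 - 1 - (ln t - t) - a * ln (1 - t)) / ln 2.
  rewrite /lg /B_alpha -/c; congr (_ / _).
  rewrite !lnM ?posrE ?mulr_gt0 ?powR_gt0 ?expR_gt0 // expRK ln_powR lnt ln1t /t.
  by ring.
apply: (@limn_esup_le_lim _ _ v).
  near=> n; have n0 : (0 < n)%N by near: n; exists 1%N.
  (* The alphabet is eventually nonempty because [S n / n] tends to [a > 0]. *)
  have Sn0 : (0 < S n)%N.
    rewrite lt0n; apply/eqP => Sn.
    suff : 0 < (S n)%:R / n%:R :> R by rewrite Sn mul0r ltxx.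
    by near: n; exact: (cvgr_gt _ hS).
  have t01 : 0 < t < 1 by rewrite t0.
  apply: le_trans (minimax_red_le Sn0 n0 t01) _; rewrite lee_fin.
  rewrite le_eqVlt; apply/orP; left; apply/eqP; rewrite /v; congr (_ / _).
  have : (n%:R : R) != 0 by rewrite pnatr_eq0 -lt0n.
  move: (ln t) (ln (1 - t)) (ln (n%:R : R)) (n%:R : R) => A B D N N0.
  by field.
apply: cvgMr_tmp; apply: cvgB; last by apply: cvgMr_tmp.
apply: cvgB; last exact: cvg_cst.
apply: cvgB; last exact: cvg_cst.
by apply: cvgD; [exact: cvg_invn | exact: cvg_ln_divn].
Unshelve. all: by end_near. Qed.

Lemma minimax_red_liminf_ge (R : realType) (a : R) (S : nat -> nat) : 0 < a ->
  (fun n => (S n)%:R / n%:R : R) @ \oo --> a ->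
  ((a / 2 * lg (expR 1 / (2 * pi * a)))%:E
     <= limn_einf (fun n => minimax_red R (S n) n))%E.
Proof.
move=> a0 hS.
pose b (n : nat) : R := (S n)%:R / n%:R.
have pi0 := pi_gt0 R.
(* The bound at [L = n]: pulling [n] out of the Gaussian mass leaves [sqrt (2 pi / b)] plus a
   vanishing [1 / n], while the larger grid costs only [2 ln n / n]. The term [b / 2] is [b] from
   the binomial minus [b / 2] from the decoder. *)
pose v (n : nat) := (b n * (- ln (b n) - ln (Num.sqrt (2 * pi / b n) + n%:R^-1))
  + b n / 2 - (n%:R^-1 + 2 * (ln n%:R / n%:R))) / ln 2.
have -> : a / 2 * lg (expR 1 / (2 * pi * a)) =
   (a * (- ln a - ln (Num.sqrt (2 * pi / a) + 0)) + a / 2 - (0 + 2 * 0)) / ln 2.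
  rewrite /lg mulrA; congr (_ / _); rewrite addr0 ln_sqrt ?divr_gt0 ?mulr_gt0 //.
  rewrite !ln_div ?posrE ?expR_gt0 ?mulr_gt0 // expRK.
  by rewrite (lnM (x := 2 * pi)) ?posrE ?mulr_gt0 //; field.
apply: (@limn_einf_ge_lim _ _ v).
  near=> n; have n0 : (0 < n)%N by near: n; exists 1%N.
  have b0 : 0 < b n by near: n; exact: (cvgr_gt _ hS).
  move: b0; rewrite /v /b; case: (S n) => [|s]; first by rewrite mul0r ltxx.
  move=> _; have nR : (0 : R) < n%:R by rewrite ltr0n.
  have sR : (0 : R) < s.+1%:R by rewrite ltr0n.
  apply: le_trans (minimax_red_ge R s n0 n0); rewrite lee_fin.
  rewrite ler_pM2r ?invr_gt0 ?ln2_gt0 //.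
  have := @ln_bin_ge R s (n * n); rewrite muln_gt0 n0 => /(_ isT).
  have -> : ln ((n * n)%:R : R) = 2 * ln n%:R by rewrite natrM lnM ?posrE // mulr_natl.
  have n1 : (n%:R : R) != 0 by rewrite gt_eqF.
  have s1 : (s.+1%:R : R) != 0 by rewrite gt_eqF.
  have -> : Num.sqrt (2 * pi * (n%:R * n%:R ^+ 2 / s.+1%:R)) + 1 =
      n%:R * (Num.sqrt (2 * pi / (s.+1%:R / n%:R)) + n%:R^-1) :> R.
    have -> : 2 * pi * (n%:R * n%:R ^+ 2 / s.+1%:R) =
        n%:R ^+ 2 * (2 * pi / (s.+1%:R / n%:R)) :> R.
      by move: (s.+1%:R : R) (n%:R : R) s1 n1 => x y x0 y0; field; rewrite x0 y0.
    by rewrite sqrtrM ?sqr_ge0 // sqrtr_sqr (ger0_norm (ltW nR)) [RHS]mulrDr divff.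
  rewrite ln_div ?posrE // [ln (n%:R * _)]lnM ?posrE //; last first.
    by rewrite ltr_wpDl ?sqrtr_ge0 ?invr_gt0.
  move: (ln (Num.sqrt _ + _)) => X h.
  rewrite -ler_pdivrMl ?invr_gt0 // invrK; apply: le_trans; last first.
    apply: lerB; last exact: lexx.
    apply: lerB; [exact: h | exact: lexx].
  rewrite le_eqVlt; apply/orP; left; apply/eqP.
  move: (ln (s.+1%:R : R)) (ln (n%:R : R)) => A B.
  by move: (s.+1%:R : R) (n%:R : R) s1 n1 => x y x0 y0; field.
apply: cvgMr_tmp; apply: cvgB; last first.
  apply: cvgD; first exact: cvg_invn.
  by apply: cvgMl_tmp; exact: cvg_ln_divn.
apply: cvgD; last exact: cvgMr_tmp.
apply: cvgM => //; apply: cvgB.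
  by apply: cvgN; apply: continuous_cvg hS; exact: continuous_ln.
apply: continuous_cvg.
  by apply: continuous_ln; rewrite addr0 sqrtr_gt0 divr_gt0 ?mulr_gt0.
apply: cvgD; last exact: cvg_invn.
apply: continuous_cvg; first exact: sqrt_continuous.
by apply: cvgMl_tmp; apply: cvgV => //; rewrite gt_eqF.
Unshelve. all: by end_near. Qed.

Unset Implicit Arguments.

Theorem theorem3 (R : realType) (a : R) (S : nat -> nat)
  (ha : 0 < a < expR 1 / (2 * pi))
  (hS : (fun n => (S n)%:R / n%:R : R) @ \oo --> a) :
  ((a / 2 * lg (expR 1 / (2 * pi * a)))%:E
     <= limn_einf (fun n => minimax_red R (S n) n))%E /\
  (limn_esup (fun n => minimax_red R (S n) n)
     <= (lg (B_alpha a))%:E)%E.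
Proof.
have /andP[a0 _] := ha.
by split; [exact: minimax_red_liminf_ge | exact: minimax_red_limsup_le].
Qed.
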